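(* There exists a non-finitely related semigroup $\mathbf{T}$ such that $\mathbf{T}^1$ is finitely related.
   Context: An operation $f:A^n\to A$ preserves a relation $R\subseteq A^k$ if $f(r_1,\dots,r_n)\in R$ for all $r_1,\dots,r_n\in R$, with $f$ applied coordinatewise. An algebra $\mathbf{A}$ with universe $A$ is finitely related if there is a finite set of finitary relations on $A$ such that the finitary operations on $A$ preserving all of those relations are precisely the term functions of $\mathbf{A}$; otherwise it is non-finitely related. Semigroups are regarded as algebras with a single binary operation; the $n$-ary term functions of a semigroup are those induced by words in $n$ variables. $\mathbf{T}^1$ denotes the monoid obtained from $\mathbf{T}$ by adjoining an identity element (with the usual convention $\mathbf{T}^1=\mathbf{T}$ if $\mathbf{T}$ already has an identity). *)

(* Defs.v *)
From HB Require Import structures.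
From mathcomp Require Import all_boot.
From mathcomp Require Import boolp.

Set Implicit Arguments.
Unset Strict Implicit.
Unset Printing Implicit Defensive.

Definition operation (A : Type) (n : nat) := ('I_n -> A) -> A.

Definition relation (A : Type) (k : nat) := ('I_k -> A) -> Prop.

Definition preserves (A : Type) (n k : nat)
    (f : operation A n) (R : relation A k) : Prop :=
  forall r : 'I_n -> 'I_k -> A,
    (forall i, R (r i)) -> R (fun j => f (fun i => r i j)).

(* [C n f] means that [f] is one of the [n]-ary term functions of an algebra
   with universe [A].  As usual in clone theory operations have arity at least
   1; since relations may be empty, and an empty relation is preserved by every
   operation of positive arity but by no nullary one, allowing nullary
   operations would not change the notion for algebras, such as semigroups,
   that have no nullary term functions. *)
Definition finitely_related (A : Type)
    (C : forall n : nat, operation A n -> Prop) : Prop :=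
  exists (m : nat) (k : 'I_m -> nat) (R : forall i : 'I_m, relation A (k i)),
  forall (n : nat) (f : operation A n), 0 < n ->
    (forall i : 'I_m, preserves f (R i)) <-> C n f.

(* The nonempty word [i :: w] in the variables indexed by ['I_n]. *)
Definition word_operation (S : semigroupType) (n : nat)
    (i : 'I_n) (w : seq 'I_n) : operation S n :=
  fun x => foldl (fun a j => (a * x j)%g) (x i) w.

Definition semigroup_term_function (S : semigroupType) (n : nat)
    (f : operation S n) : Prop :=
  exists (i : 'I_n) (w : seq 'I_n), f =1 word_operation i w.

Definition finitely_related_semigroup (S : semigroupType) : Prop :=
  finitely_related (@semigroup_term_function S).

Definition has_identity (S : semigroupType) : Prop :=
  exists e : S, left_id e (@mul S) /\ right_id e (@mul S).

(* [S] with a new element [None], which is made the identity. *)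
Definition add_identity (S : semigroupType) : Type := option S.

Section AddIdentity.
Variable S : semigroupType.

HB.instance Definition _ := Choice.copy (add_identity S) (option S).

Definition add_identity_mul (x y : add_identity S) : add_identity S :=
  match x, y with
  | Some a, Some b => Some (a * b)%g
  | Some _, None => x
  | None, _ => y
  end.

Fact add_identity_mulA : associative add_identity_mul.
Proof. by move=> [x|] [y|] [z|] //=; rewrite mulgA. Qed.

HB.instance Definition _ :=
  isSemigroup.Build (add_identity S) add_identity_mulA.

Fact add_identity_mul1 : left_id (None : add_identity S) mul.
Proof. by case. Qed.

Fact add_identity_mulr1 : right_id (None : add_identity S) mul.
Proof. by case. Qed.

HB.instance Definition _ :=
  Semigroup_isMonoid.Build (add_identity S) add_identity_mul1 add_identity_mulr1.

End AddIdentity.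

(* S^1, with multiplication as its only operation. *)
Definition semigroup1 (S : semigroupType) : semigroupType :=
  if pselect (has_identity S) then S else add_identity S.

(* Main.v *)
Require Import Defs.
From HB Require Import structures.
From mathcomp Require Import all_boot.
From mathcomp Require Import boolp.
From mathcomp Require Import zify.

Set Implicit Arguments.
Unset Strict Implicit.
Unset Printing Implicit Defensive.

(** The semigroup T is finite, and its elements are words over two letters
    a = [true] and b = [false] that carry a flag.  Multiplication concatenates
    the words and takes the disjunction of the flags, after which the result is
    brought to a normal form.  A word in which some letter occurs more than
    twice becomes zero.  If the flag is set, then words of length four are also
    seen less sharply: aabb and bbaa are identified, and abab, abba, baab and
    baba become zero.  Unflagged words thus form a nilpotent semigroup, flagged
    words form a nilpotent monoid whose identity is the flagged empty word, and
    T^1 arises from T by adding the unflagged empty word.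

    Why T is not finitely related.  Let w be a word in n variables that each
    occur twice, and regard the two occurrences of a variable as the end points
    of an interval.  In T every variable receives either a nonempty word or a
    set flag.  If n is at least 3, the value of w is therefore zero or flagged,
    and all it reveals about w is, for one pair of variables at a time, whether
    the two intervals are disjoint: this is seen by substituting a and b for the
    two variables and the flagged empty word for the others
    ([eval_visible], [eval_invisible]).  So the term function of w amounts to
    the intersection graph of its intervals.  Let f be the operation that
    corresponds in this way to the cycle of length n at least 4.  A cycle is not
    an interval graph, since the interval that closes first meets pairwise
    intersecting intervals ([first_to_close]); hence f is not a term function.
    But K argument tuples test at most K pairs of variables.  If n > K, some
    edge of the cycle is not tested, and without that edge the cycle is a path,
    which is an interval graph ([separated_arc_word]).  So f agrees with term
    functions on any K tuples, and preserves all K-ary relations that the term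
    functions preserve.

    Why T^1 is finitely related.  Now variables can be deleted by substituting
    the identity, without setting a flag.  With unflagged a, b and the identity
    one reads off from an operation f that agrees locally with term functions
    how often each variable occurs (once, twice or more often), and the exact
    order in which the occurrences of two variables alternate if both occur at
    most twice.  These orders on pairs are consistent on any three variables,
    and so come from one word ([glue_restrictions]).  Conversely the value of a
    word at a tuple is determined by the variables that occur, by the presence
    of a variable that occurs three times, and by the restrictions of the word
    to pairs among at most five variables; so this word induces f
    ([term_of_local]).

    Both halves use that an operation preserves all K-ary relations invariant
    under the term functions if and only if it agrees with some term function
    on any K tuples. *)

(** * Finite relatedness and local agreement with term functions *)

Definition locally_term (S : semigroupType) (K n : nat) (f : operation S n) :=
  forall ps : seq ('I_n -> S), size ps <= K ->
  exists i w, forall p, List.In p ps -> f p = word_operation i w p.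

Lemma In_map_mem (I : eqType) (A : Type) (g : I -> A) s i :
  i \in s -> List.In (g i) (map g s).
Proof. by elim: s => //= j s IHs; rewrite inE => /predU1P[->|/IHs]; [left|right]. Qed.

Lemma word_operation_closed (S : semigroupType) (k n : nat) (R : relation S k)
    (i : 'I_n) (w : seq 'I_n) :
  (forall s t, R s -> R t -> R (fun j => s j * t j)%g) ->
  preserves (word_operation i w) R.
Proof.
move=> Rmul r Rr; rewrite /word_operation.
suff: forall s, R s -> R (fun j => foldl (fun a l => (a * r l j)%g) (s j) w).
  by apply; exact: Rr.
elim: w => [|l w IHw] s Rs //=.
by apply: (IHw (fun j => s j * r l j)%g); apply: Rmul Rs (Rr l).
Qed.

Lemma word_operation_mul (S : semigroupType) n (i j : 'I_n) v w (p : 'I_n -> S) :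
  (word_operation i v p * word_operation j w p)%g
    = word_operation i (v ++ j :: w) p.
Proof.
rewrite /word_operation foldl_cat /=.
elim/last_ind: w => [//|w l IHw].
by rewrite !foldl_rcons mulgA IHw.
Qed.

(** Invariance of a relation of arity at most K only involves the values of an
    operation at K tuples, the columns of the matrix with the given rows. *)
Lemma not_finitely_related_of_locally_term (S : semigroupType) :
  (forall K, exists n (f : operation S n),
     [/\ 0 < n, locally_term K f & ~ semigroup_term_function f]) ->
  ~ finitely_related_semigroup S.
Proof.
move=> H [m [k [R HR]]].
have [n [f [n0 floc]]] := H (\max_i k i); apply.
apply/(HR n f n0) => i r Rr.
pose ps := [seq (fun l => r l j) | j <- enum 'I_(k i)].
have [|l [w Hw]] := floc ps.
  by rewrite size_map size_enum_ord leq_bigmax.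
have -> : (fun j => f (fun i0 => r i0 j))
        = (fun j => word_operation l w (fun i0 => r i0 j)).
  apply/funext => j; apply: Hw.
  by apply: (In_map_mem (fun j l => r l j)); rewrite mem_enum.
by apply: (iffRL (HR n (word_operation l w) n0)) Rr; exists l, w.
Qed.

(** A finite algebra has finitely many K-ary relations, so all the invariant ones
    can be used at once.  Applied to the relation formed by the values of the
    term functions at K given tuples, invariance yields a term function that
    agrees with the operation there.  The finiteness of S enters through the
    embedding [g], which allows the relations to be enumerated. *)
Lemma finitely_related_of_locally_term (S : semigroupType) (F : finType)
    (g : S -> F) (K : nat) : injective g ->
  (forall n (f : operation S n), 0 < n ->
     locally_term K f -> semigroup_term_function f) ->
  finitely_related_semigroup S.
Proof.
move=> g_inj H.
pose code (t : 'I_K -> S) := [ffun j => g (t j)].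
pose closed (X : {set {ffun 'I_K -> F}}) := forall s t,
  code s \in X -> code t \in X -> code (fun j => s j * t j)%g \in X.
exists #|{: {set {ffun 'I_K -> F}}}|, (fun=> K),
  (* A set that is not closed is turned into the full relation. *)
  (fun i t => closed (enum_val i) -> code t \in enum_val i) => n f n0.
split=> [fR|[i [w fw]] x].
  apply: H => // -[|p0 ps] psK; first by exists (Ordinal n0), [::].
  pose p (j : 'I_K) := nth p0 (p0 :: ps) j.
  pose X := [set t : {ffun 'I_K -> F} |
    `[< exists i w, t = code (fun j => word_operation i w (p j)) >]].
  have Xcl : closed X.
    move=> s t; rewrite !inE => /asboolP[i [v sv]] /asboolP[j [w tw]].
    apply/asboolP; exists i, (v ++ j :: w); apply/ffunP => l; rewrite !ffunE.
    have /ffunP/(_ l) := sv; have /ffunP/(_ l) := tw.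
    by rewrite !ffunE => /g_inj -> /g_inj ->; rewrite word_operation_mul.
  have : code (fun j => f (p j)) \in X.
    have := fR (enum_rank X) (fun i j => p j i); rewrite enum_rankK; apply=> // i _.
    by rewrite inE; apply/asboolP; exists i, [::].
  rewrite inE => /asboolP[i [w /ffunP ew]]; exists i, w => q qps.
  have [j [jK <-]] := List.In_nth _ _ p0 qps.
  have jK' : j < K by apply: leq_trans psK; apply/ltP.
  have := ew (Ordinal jK'); rewrite !ffunE => /g_inj; rewrite /p /=.
  by have -> : nth p0 (p0 :: ps) j = List.nth j (p0 :: ps) p0
    by elim: {+}(_ :: _) {+}j => [|? ? IH] [|?] //=.
move=> r Rr cl; have -> : (fun j => f (fun i0 => r i0 j))
        = (fun j => word_operation i w (fun i0 => r i0 j)).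
  by apply/funext => j; rewrite fw.
apply: (@word_operation_closed S K n (fun t => code t \in enum_val x)) => //.
by move=> l; exact: Rr.
Qed.

(** * Words and their restrictions to pairs of letters *)

Definition restrict (I : eqType) (i j : I) (w : seq I) := filter (pred2 i j) w.
Arguments restrict {I} i j w : simpl never.

Lemma restrictC (I : eqType) (i j : I) w : restrict i j w = restrict j i w.
Proof. by apply: eq_filter => x /=; rewrite orbC. Qed.

Lemma restrict_diag (I : eqType) (i : I) w : restrict i i w = nseq (count_mem i w) i.
Proof.
rewrite -size_filter /restrict; have -> : filter (pred2 i i) w = filter (pred1 i) w.
  by apply: eq_filter => x /=; rewrite orbb.
by apply/all_pred1P; rewrite filter_all.
Qed.

Lemma eq_from_restrict (I : eqType) (u v : seq I) :
  {in u ++ v &, forall i j, restrict i j u = restrict i j v} -> u = v.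
Proof.
elim: u v => [|x u IHu] [|y v] //= H.
- by have := H y y; rewrite /restrict /= eqxx !mem_head => /(_ isT isT).
- by have := H x x; rewrite /restrict /= eqxx !mem_head => /(_ isT isT).
have xy : x = y.
  have := H x y; rewrite /restrict /= !eqxx /= !inE !mem_cat !inE !eqxx !orbT.
  by move=> /(_ isT isT)[].
rewrite -{y}xy in H *; congr (_ :: _); apply: IHu => i j iuv juv.
have sub k : k \in u ++ v -> k \in x :: u ++ x :: v.
  by rewrite !(mem_cat, inE) => /orP[]->; rewrite !orbT.
have := H i j (sub i iuv) (sub j juv); rewrite /restrict /=.
by case: ifP => // _ [].
Qed.

(** Being the first of the letters i and j to occur is a transitive relation. *)
Lemma ohead_restrict_trans (I : eqType) (i j k : I) u : i != j -> j != k ->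
  ohead (restrict i j u) = Some j -> ohead (restrict j k u) = Some k ->
  i != k /\ ohead (restrict i k u) = Some k.
Proof.
move=> ij jk; rewrite /restrict; elim: u => //= x u IHu.
have [->|xi] := eqVneq x i; first by case=> /eqP; rewrite (negPf ij).
have [->|xj] /= := eqVneq x j; first by move=> _ [] /eqP; rewrite (negPf jk).
have [xk|//] /= := eqVneq x k; rewrite -xk eq_sym; by split.
Qed.

(** The common first letter can be split off from a consistent family: on each
    pair of letters, a word of the family tells which letter comes first, and
    consistency on triples makes this a total preorder, so that some letter i
    comes first against all others.  Removing its first occurrence from the
    words that involve i leaves a consistent family of smaller size. *)
Lemma glue_restrictions (I : finType) (G : {pred I}) (W : I -> I -> seq I) :
  (forall i j k, i \in G -> j \in G -> k \in G -> exists u,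
     {in [:: i; j; k] &, forall x y, restrict x y u = W x y}) ->
  exists w, {subset w <= G} /\ {in G &, forall i j, restrict i j w = W i j}.
Proof.
have [m] := ubnP (\sum_(i in G) size (W i i)).
elim: m W => [|m IHm] W // mP H.
have WC i j : i \in G -> j \in G -> W i j = W j i.
  move=> iG jG; have [u Hu] := H i j j iG jG jG.
  by rewrite -(Hu i j) ?inE ?eqxx ?orbT // restrictC Hu ?inE ?eqxx ?orbT.
pose V := [pred i in G | W i i != [::]].
have [/existsP[i0 i0V]|V0] := boolP [exists i, i \in V]; last first.
  exists [::]; split=> // i j iG jG.
  have [u Hu] := H i j j iG jG jG.
  have nil k : k \in [:: i; j; j] -> k \in G -> k \notin u.
    move=> kS kG; have := Hu k k kS kS; rewrite restrict_diag.
    have := V0; rewrite negb_exists => /forallP/(_ k); rewrite !inE kG /= negbK.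
    by move=> /eqP-> /(congr1 size); rewrite size_nseq => /count_memPn.
  rewrite -Hu ?inE ?eqxx ?orbT //; symmetry; apply/eqP; rewrite -[_ == _]negbK -has_filter.
  apply/hasPn => x xu /=; apply: contraL xu => /orP[]/eqP->; apply: nil => //;
    by rewrite !inE eqxx ?orbT.
(* A letter preceded by the fewest other letters is preceded by none. *)
have [i iV iP] : exists2 i, i \in V & {in G, forall j, ohead (W i j) = Some i}.
  pose before i := [set j in V | (i != j) && (ohead (W i j) == Some j)].
  case: (arg_minnP (fun i => #|before i|) i0V) => i iV imin; exists i => // j jG.
  have iG : i \in G by case/andP: iV.
  have [u Hu] := H i j j iG jG jG.
  have iu : i \in restrict i j u.
    rewrite mem_filter /= eqxx -has_pred1 has_count //=.
    have := Hu i i; rewrite !inE eqxx restrict_diag => /(_ isT isT) E.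
    by case/andP: iV => _; rewrite -E; case: (count_mem i u).
  case def_W : (W i j) => [|c v] /=.
    by move: iu; rewrite Hu ?def_W // !inE eqxx ?orbT.
  have : c \in restrict i j u by rewrite Hu ?def_W ?mem_head // !inE eqxx ?orbT.
  rewrite mem_filter /= => /andP[cij cu].
  have [-> //|ci] := eqVneq c i; move: cij; rewrite (negPf ci) /= => /eqP cj.
  move: ci def_W cu {iu}; rewrite {c}cj => ji def_W ju.
  have jV : j \in V.
    rewrite inE jG /= -Hu ?inE ?eqxx ?orbT // restrict_diag -size_eq0 size_nseq.
    by rewrite -lt0n -has_count has_pred1.
  have := imin j jV; rewrite leqNgt => /negP[]; apply/proper_card/properP; split.
    apply/subsetP => k; rewrite !inE => /and3P[/andP[kG kV] jk /eqP Wjk].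
    have [u' Hu'] := H i j k iG jG kG; rewrite kG kV /=.
    have [||//|ik E] := @ohead_restrict_trans I i j k u' _ jk.
    - by rewrite eq_sym.
    - by rewrite Hu' ?def_W // !inE eqxx ?orbT.
    - by rewrite Hu' // !inE eqxx ?orbT.
    by rewrite ik -Hu' ?E ?inE ?eqxx ?orbT.
  by exists j; rewrite !inE ?eqxx ?andbF // jG (eq_sym i) ji def_W eqxx; case/andP: jV => _ ->.
have iG : i \in G by case/andP: iV.
pose W' x y := if (x == i) || (y == i) then behead (W x y) else W x y.
have WE x y : x \in G -> y \in G -> W x y = if (x == i) || (y == i) then i :: W' x y else W' x y.
  move=> xG yG; rewrite /W'; case xyi: (_ || _) => //.
  case/orP: xyi => /eqP E.
    by rewrite E; have := iP y yG; case: (W i y) => //= ? ? [->].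
  by rewrite E WC //; have := iP x xG; case: (W i x) => //= ? ? [->].
have [| |w [wG Hw]] := IHm W'.
- rewrite -ltnS; apply: leq_trans mP; rewrite ltnS.
  rewrite (bigD1 i iG) [in X in _ < X](bigD1 i iG) /= (WE i i) // eqxx /= addSn ltnS.
  by rewrite leq_add2l leq_sum // => j /andP[_ ji]; rewrite /W' (negPf ji).
- move=> x y z xG yG zG; have [u Hu] := H x y z xG yG zG.
  set S := [:: x; y; z] in Hu *.
  have SG : {subset S <= G} by move=> t; rewrite !inE => /or3P[]/eqP->.
  have [iS|iS] := boolP (i \in S); last first.
    exists u => a b aS bS; rewrite Hu // /W'.
    case: ifP => // abi; case/orP: abi => /eqP E; move: iS; by rewrite -E ?aS ?bS.
  pose u1 := [seq t <- u | t \in S].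
  have Hu1 : {in S &, forall a b, restrict a b u1 = W a b}.
    move=> a b aS bS; rewrite -Hu // /restrict -filter_predI; apply: eq_filter => t /=.
    by case: eqP => [->|_]; [rewrite aS|case: eqP => [->|_]; rewrite ?bS].
  case def_u1 : u1 => [|c u2].
    by have := iP i iG; rewrite -Hu1 // def_u1.
  have cS : c \in S by have := mem_head c u2; rewrite -def_u1 mem_filter => /andP[].
  have ci : c = i.
    have := iP c (SG c cS); rewrite -Hu1 // def_u1 /restrict /= eqxx orbT /=.
    by case.
  rewrite {c cS}ci in def_u1; exists u2 => a b aS bS.
  rewrite /W' -Hu1 // def_u1 /restrict /= !(eq_sym i).
  by case: (_ || _).
exists (i :: w); split=> [t|x y xG yG]; first by rewrite inE => /predU1P[->//|/wG].
by rewrite WE // /restrict /= !(eq_sym i) -/(restrict _ _ _) Hw //.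
Qed.

(** * The semigroup of flagged words *)

Notation flagged_word := (bool * seq bool)%type.

Definition at_most_twice (u : seq bool) := (count_mem true u <= 2) && (count_mem false u <= 2).

(** Any word with a triple letter could serve as the normal form of zero; this
    choice makes [normal_word] truncate the powers of a at exponent 3. *)
Definition zero_word := nseq 3 true.

(** The intervals spanned by the two occurrences of a and of b are disjoint. *)
Definition separated (T : eqType) (a b : T) (u : seq T) :=
  u \in [:: [:: a; a; b; b]; [:: b; b; a; a]].

Definition normal_word (d : bool) (u : seq bool) :=
  if ~~ at_most_twice u then zero_word
  else if d && (size u == 4) then
    if separated true false u then [:: true; true; false; false] else zero_word
  else u.

Definition normal (x : flagged_word) : flagged_word := (x.1, normal_word x.1 x.2).

Definition concat (x y : flagged_word) : flagged_word := (x.1 || y.1, x.2 ++ y.2).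

Lemma size_count_bool u : size u = count_mem true u + count_mem false u.
Proof. by rewrite -(count_predC (pred1 true)); congr (_ + _); apply: eq_count => -[]. Qed.

Lemma bad_size u : 4 < size u -> at_most_twice u = false.
Proof. by rewrite /at_most_twice size_count_bool; lia. Qed.

Lemma bad_catl u v : ~~ at_most_twice u -> at_most_twice (u ++ v) = false.
Proof. by rewrite /at_most_twice !count_cat; lia. Qed.

Lemma bad_catr u v : ~~ at_most_twice v -> at_most_twice (u ++ v) = false.
Proof. by rewrite /at_most_twice !count_cat; lia. Qed.

(** Where normalisation changes a word, any further letter leads to zero, both
    before and after the change; this makes it compatible with concatenation. *)
Lemma normal_wordP d u :
  [\/ normal_word d u = u, ~~ at_most_twice u /\ normal_word d u = zero_word |
     [/\ d, size u = 4 & size (normal_word d u) = 4 \/ normal_word d u = zero_word] ].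
Proof.
rewrite /normal_word; case: ifP => [gu|_]; first by apply: Or32.
case: ifP => [/andP[-> /eqP us]|_]; last by apply: Or31.
by apply: Or33; split=> //; case: ifP => _; [left|right].
Qed.

Lemma normal_word_id d e u : d ==> e -> normal_word e (normal_word d u) = normal_word e u.
Proof.
rewrite /normal_word; have [gu|//] := boolP (at_most_twice u).
case: d e => -[] //= _; rewrite ?gu //.
have [u4|u4] := eqVneq (size u) 4; first by case: (separated _ _ _).
by rewrite gu /= (negPf u4).
Qed.

Lemma normal_word_bad d u : at_most_twice u = false -> normal_word d u = zero_word.
Proof. by rewrite /normal_word => ->. Qed.

Lemma normal_word_catl d e u v :
  d ==> e -> normal_word e (normal_word d u ++ v) = normal_word e (u ++ v).
Proof.
case: v => [|c v] de; first by rewrite !cats0 normal_word_id.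
case: (normal_wordP d u) => [->//|[gu ->]|[dT u4 H]].
  by rewrite !normal_word_bad // bad_catl.
rewrite !(@normal_word_bad e) //; first by rewrite bad_size // size_cat /=; lia.
case: H => [n4|->]; last by rewrite bad_catl.
by rewrite bad_size // size_cat /=; lia.
Qed.

Lemma normal_word_catr d e u v :
  d ==> e -> normal_word e (v ++ normal_word d u) = normal_word e (v ++ u).
Proof.
case: v => [|c v] de; first by rewrite normal_word_id.
case: (normal_wordP d u) => [->//|[gu ->]|[dT u4 H]].
  by rewrite !normal_word_bad // bad_catr.
rewrite !(@normal_word_bad e) //; first by rewrite bad_size // size_cat /=; lia.
case: H => [n4|->]; last by rewrite bad_catr.
by rewrite bad_size // size_cat /=; lia.
Qed.

Lemma normal_concat x y : normal (concat (normal x) (normal y)) = normal (concat x y).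
Proof.
case: x y => d u [e v]; rewrite /normal /concat /=; congr (_, _).
rewrite normal_word_catl ?normal_word_catr //; by [case: d|case: d; case: e].
Qed.

Lemma normal_id x : normal (normal x) = normal x.
Proof. by case: x => d u; rewrite /normal /= normal_word_id // implybb. Qed.

Lemma concatA : associative concat.
Proof. by move=> [d u] [e v] [f w]; rewrite /concat /= orbA catA. Qed.

Lemma size_normal_word d u : size (normal_word d u) <= 4.
Proof.
rewrite /normal_word; case: ifP => // /negbFE gu; case: ifP => _; first by case: ifP.
by move: gu; rewrite /at_most_twice size_count_bool; lia.
Qed.

Lemma normal_word_eq0 d u : (normal_word d u == [::]) = (u == [::]).
Proof.
case: u => [|c u]; first by case: d.
rewrite /normal_word; case: ifP => //= _; case: ifP => //= _; by case: ifP.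
Qed.

Definition identity_word : flagged_word := (false, [::]).

Lemma normal_eq1 x : (normal x == identity_word) = (x == identity_word).
Proof. by case: x => d u; rewrite /normal /identity_word /= !xpair_eqE normal_word_eq0. Qed.

Definition flag_word_pred : pred flagged_word :=
  fun x => (normal x == x) && (x != identity_word).

(** The semigroup T; the unflagged empty word is left out. *)
Definition FlagWord := {x : flagged_word | flag_word_pred x}.
HB.instance Definition _ := Choice.on FlagWord.

Lemma flag_word_mul_subproof (x y : FlagWord) : flag_word_pred (normal (concat (val x) (val y))).
Proof.
rewrite /flag_word_pred normal_id eqxx normal_eq1 /=.
case: x y => [[d u] /= /andP[_ Hx]] [[e v] /= _]; apply: contraNneq Hx.
by case: d u => -[|//]; case: e.
Qed.

Definition flag_word_mul (x y : FlagWord) : FlagWord := Sub _ (flag_word_mul_subproof x y).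

Fact flag_word_mulA : associative flag_word_mul.
Proof.
move=> [x Hx] [y Hy] [z Hz]; apply: val_inj => /=.
rewrite -[LHS]normal_concat normal_id normal_concat.
by rewrite -[RHS]normal_concat normal_id normal_concat concatA.
Qed.

HB.instance Definition _ := isSemigroup.Build FlagWord flag_word_mulA.

Lemma val_flag_word_mul (x y : FlagWord) : val (x * y)%g = normal (concat (val x) (val y)).
Proof. by []. Qed.

Lemma normal_val (x : FlagWord) : normal (val x) = val x.
Proof. by case: x => x /= /andP[/eqP]. Qed.

Definition flagged_nil : FlagWord := Sub (true, [::]) isT.
Definition to_flag_word (x : flagged_word) : FlagWord := insubd flagged_nil (normal x).

Lemma val_to_flag_word x : x != identity_word -> val (to_flag_word x) = normal x.
Proof. by move=> x1; rewrite val_insubd /flag_word_pred normal_id eqxx normal_eq1 x1. Qed.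

(** An identity would be unflagged and empty, as is seen by multiplying it with
    the unflagged word a. *)
Lemma flag_word_no_identity : ~ has_identity FlagWord.
Proof.
case=> e [eP _]; have /(congr1 val) := eP (to_flag_word (false, [:: true])).
rewrite val_flag_word_mul val_to_flag_word // -{1}(normal_val e) normal_concat.
case: e {eP} => -[d u] Hd /=; rewrite /normal /concat /=.
case: d Hd => //= /andP[_ u1].
case: u u1 => // c u _ []; rewrite /normal_word /=.
by case: ifP => //; case: u.
Qed.

Definition unfold1 (x : add_identity FlagWord) : flagged_word :=
  if x is Some y then val y else identity_word.

Definition fold1 (x : flagged_word) : add_identity FlagWord := insub (normal x).

Lemma unfold1K x : unfold1 (fold1 x) = normal x.
Proof.
rewrite /fold1; case: insubP => [y _ //|/=].
by rewrite /flag_word_pred normal_id eqxx negbK => /eqP.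
Qed.

Lemma unfold1_inj : injective unfold1.
Proof.
have ne1 (x : FlagWord) : val x <> identity_word by case: x => x /= /andP[_ /eqP].
move=> [x|] [y|] //= E; first by congr Some; apply: val_inj.
  by case: (ne1 x).
by case: (ne1 y).
Qed.

Lemma normal_unfold1 x : normal (unfold1 x) = unfold1 x.
Proof. by case: x => [x|//]; apply: normal_val. Qed.

Lemma unfold1_mul (x y : add_identity FlagWord) : unfold1 (x * y)%g = normal (concat (unfold1 x) (unfold1 y)).
Proof.
rewrite -[LHS]normal_unfold1; case: x => [x|]; case: y => [y|] //=.
- by rewrite normal_id.
- by rewrite /concat /= orbF cats0; case: (sval x).
Qed.

(** The value of a word before normalisation. *)
Definition eval_word (n : nat) (p : 'I_n -> flagged_word) (w : seq 'I_n) : flagged_word :=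
  (has (fun i => (p i).1) w, flatten [seq (p i).2 | i <- w]).

Lemma eval_word_operation (S : semigroupType) (h : S -> flagged_word) n (i : 'I_n) w p :
  (forall x, normal (h x) = h x) ->
  (forall x y : S, h (x * y)%g = normal (concat (h x) (h y))) ->
  h (word_operation i w p) = normal (eval_word (h \o p) (i :: w)).
Proof.
move=> hN hM; rewrite /word_operation /eval_word.
elim/last_ind: w => [|w j IHw] /=.
  by rewrite orbF cats0 -[LHS]hN; case: (h _).
rewrite foldl_rcons hM IHw -(hN (p j)) normal_concat /concat /=.
by rewrite has_rcons map_rcons flatten_rcons catA -orbA (orbC _ (h (p j)).1).
Qed.

(** * Adjoining an identity gives a finitely related semigroup *)

Section FlattenWords.
Variables (I : eqType) (u : I -> seq bool).
Let expand w := flatten [seq u i | i <- w].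

Lemma flatten_filter_nonnil w :
  flatten [seq u i | i <- filter (fun i => u i != [::]) w] = expand w.
Proof. by rewrite /expand; elim: w => //= i w <-; case: eqP => [->|]. Qed.

Lemma bad_of_triple i w : u i != [::] -> 2 < count_mem i w -> at_most_twice (expand w) = false.
Proof.
case def_u : (u i) => [//|c v] _ iw.
have: count_mem i w <= count_mem c (expand w).
  rewrite /expand; elim: w {iw} => //= j w IHw; rewrite count_cat.
  by apply: leq_add IHw; case: eqP => // ->; rewrite def_u /= eqxx.
by rewrite /at_most_twice; case: c {def_u}; lia.
Qed.

Lemma bad_of_many R w : uniq R -> 4 < size R -> {subset R <= w} ->
  {in R, forall i, u i != [::]} -> at_most_twice (expand w) = false.
Proof.
move=> uR R5 Rw Ru; apply/bad_size/(leq_trans R5).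
rewrite -flatten_filter_nonnil.
have /(uniq_leq_size uR)/leq_trans : {subset R <= [seq i <- w | u i != [::]]}.
  by move=> i iR; rewrite mem_filter Ru // Rw.
apply; elim: (w) => //= i v; case def_u: (u i) => //= IH.
by rewrite def_u /= size_cat; lia.
Qed.

Lemma flatten_two_letters i j w : u i = [:: true] -> (j != i -> u j = [:: false]) ->
  (forall k, k != i -> k != j -> u k = [::]) ->
  expand w = map (pred1 i) (restrict i j w).
Proof.
rewrite /expand /restrict => ui uj uk; elim: w => //= k w ->.
have [->|ki] := eqVneq k i; first by rewrite ui /= eqxx.
have [->|kj] := eqVneq k j; last by rewrite uk.
have [->|ji] := eqVneq j i; first by rewrite ui /= eqxx.
by rewrite uj //= (negPf ji).
Qed.

End FlattenWords.

Lemma normal_word_nseq d c : normal_word d (nseq c true) = nseq (minn c 3) true.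
Proof. by case: c d => [|[|[|c]]] [] //; rewrite normal_word_bad // (minn_idPr _). Qed.

(** Substituting a for i and b for j loses nothing about the restriction to i
    and j, as long as normalisation does not turn the value into zero. *)
Lemma decode_restrict (I : eqType) (i j : I) w :
  count_mem i w <= 2 -> count_mem j w <= 2 ->
  [seq if c then i else j | c : bool <- normal_word false (map (pred1 i) (restrict i j w))]
  = restrict i j w.
Proof.
move=> ci cj; rewrite /normal_word ifF; last first.
  apply/negbF; rewrite /at_most_twice !count_map; apply/andP; split.
    apply: leq_trans ci; rewrite count_filter; apply: sub_count => x /=.
    by rewrite eqb_id => /andP[].
  apply: leq_trans cj; rewrite count_filter; apply: sub_count => x /=.
  by case: (x == i).
rewrite /= /restrict -map_comp -[RHS]map_id; apply/eq_in_map => x; rewrite mem_filter /=.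
by case: eqVneq => [->|_] //= /andP[/eqP].
Qed.

Section FinitelyRelated.

Let S : semigroupType := add_identity FlagWord.

Definition point n (x : 'I_n -> flagged_word) : 'I_n -> S := fun i => fold1 (x i).

Lemma unfold1_point n (x : 'I_n -> flagged_word) i : unfold1 (point x i) = normal (x i).
Proof. exact: unfold1K. Qed.

(** For i = j the tuple has a single nontrivial entry, a. *)
Definition test n (i j : 'I_n) : 'I_n -> flagged_word :=
  fun k => (false, if k == i then [:: true] else if k == j then [:: false] else [::]).

Definition indicator n (J : seq 'I_n) : 'I_n -> flagged_word :=
  fun k => (false, if k \in J then [:: true] else [::]).

Lemma eval_test n (i j : 'I_n) w :
  eval_word (@unfold1 \o point (test i j)) w = (false, map (pred1 i) (restrict i j w)).
Proof.
rewrite /eval_word; congr (_, _); first by apply/hasPn => k _ /=; rewrite unfold1_point.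
apply: flatten_two_letters => [|/negPf ji|k /negPf ki /negPf kj] /=;
  by rewrite unfold1_point /= /test ?eqxx ?ji ?ki ?kj.
Qed.

Lemma eval_indicator n (J : seq 'I_n) w :
  (eval_word (@unfold1 \o point (indicator J)) w == identity_word) = all (fun i => i \notin J) w.
Proof.
rewrite /eval_word /identity_word xpair_eqE.
have -> : has (fun i => ((@unfold1 \o point (indicator J)) i).1) w = false.
  by apply/hasPn => k _ /=; rewrite /point unfold1K.
rewrite eqxx /=; elim: w => //= k w IHw; rewrite unfold1_point /indicator /=.
by case: ifP.
Qed.

Variables (n : nat) (f : operation S n).

Definition agrees w p := unfold1 (f p) = normal (eval_word (@unfold1 \o p) w).

(* The bound 51 counts the tuples compared in [term_of_local]: the tuple at
   which the operation is computed, one tuple for the variables that do not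
   occur, and 7 * 7 tests for 7 variables. *)
Hypothesis flocal : locally_term 51 f.

Lemma local_word ps : size ps <= 51 ->
  exists2 w, w != [::] & forall p, List.In p ps -> agrees w p.
Proof.
move=> /flocal[i [w Hw]]; exists (i :: w) => // p /Hw fp; rewrite /agrees fp.
by rewrite -eval_word_operation //; [exact: normal_unfold1|exact: unfold1_mul].
Qed.

(** The number of occurrences of the variable i, truncated at 3. *)
Definition multiplicity i := size (unfold1 (f (point (test i i)))).2.

(** For variables that occur once or twice, this recovers the restriction to i
    and j of the words that agree locally with f. *)
Definition pattern i j :=
  [seq if c then i else j | c : bool <- (unfold1 (f (point (test i j)))).2].

Lemma multiplicityE w i : agrees w (point (test i i)) ->
  multiplicity i = minn (count_mem i w) 3.
Proof.
rewrite /agrees /multiplicity => ->; rewrite eval_test restrict_diag map_nseq /= eqxx.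
by rewrite normal_word_nseq size_nseq.
Qed.

Let light := [pred i | 0 < multiplicity i < 3].

Lemma patternE w i j : i \in light -> j \in light -> agrees w (point (test i i)) ->
  agrees w (point (test j j)) -> agrees w (point (test i j)) ->
  pattern i j = restrict i j w.
Proof.
move=> il jl /multiplicityE mi /multiplicityE mj; rewrite /agrees /pattern => ->.
rewrite eval_test decode_restrict //.
  by move: il; rewrite inE mi; lia.
by move: jl; rewrite inE mj; lia.
Qed.

Lemma multiplicity_le3 i : multiplicity i <= 3.
Proof.
have [v _ /(_ _ (or_introl erefl))/multiplicityE ->] := @local_word [:: point (test i i)] isT.
exact: geq_minr.
Qed.

(** A word that agrees with f at the tuple for J and at the single test of i
    contains neither i nor a letter of J; so the variables that f ignores one by
    one are ignored jointly, at the cost of a bounded number of tuples. *)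
Lemma absent_indicator J : {in J, forall i, multiplicity i = 0} ->
  unfold1 (f (point (indicator J))) = identity_word.
Proof.
elim: J => [|i J IHJ] HJ.
  have [w _ Hw] := @local_word [:: point (indicator [::])] isT.
  rewrite Hw; last by left.
  by apply/eqP; rewrite normal_eq1 eval_indicator; apply/allP.
have [w _ Hw] := @local_word
  [:: point (indicator (i :: J)); point (indicator J); point (test i i)] isT.
have /eqP : unfold1 (f (point (indicator J))) = identity_word.
  by apply: IHJ => j jJ; rewrite HJ // inE jJ orbT.
rewrite (Hw (point (indicator J))); last by right; left.
rewrite normal_eq1 eval_indicator => /allP wJ.
have /multiplicityE : agrees w (point (test i i)) by apply: Hw; right; right; left.
rewrite HJ ?mem_head // => /esym iw.
rewrite Hw; last by left.
apply/eqP; rewrite normal_eq1 eval_indicator; apply/allP => j jw.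
rewrite inE negb_or wJ // andbT; apply: contraTneq jw => ->.
by apply/count_memPn; lia.
Qed.

Lemma some_present : exists i, multiplicity i != 0.
Proof.
apply/existsP; apply: contraT; rewrite negb_exists => /forallP H.
have := @absent_indicator (enum 'I_n) (fun i _ => eqP (negPn (H i))).
have [[//|i w] _ Hw] := @local_word [:: point (indicator (enum 'I_n))] isT.
rewrite Hw; last by left.
by move=> /eqP; rewrite normal_eq1 eval_indicator /= mem_enum.
Qed.

Definition tests (X : seq 'I_n) :=
  [seq point (test ij.1 ij.2) | ij <- allpairs pair X X].

Lemma size_tests X : size (tests X) = size X * size X.
Proof. by rewrite size_map size_allpairs. Qed.

Lemma mem_tests X i j : i \in X -> j \in X -> List.In (point (test i j)) (tests X).
Proof.
move=> iX jX; apply: (In_map_mem (fun ij => point (test ij.1 ij.2)) (i := (i, j))).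
by apply/allpairsP; exists (i, j).
Qed.

(** Occurrences beyond the second need no position: it suffices to append three
    copies of every variable that occurs more than twice. *)
Lemma global_word : exists w,
  [/\ forall i, (i \in w) = (multiplicity i != 0),
      forall i, multiplicity i = 3 -> 2 < count_mem i w &
      {in light &, forall i j, restrict i j w = pattern i j}].
Proof.
have [|w [wl Hw]] := @glue_restrictions _ light pattern.
  move=> i j k il jl kl; pose X := [:: i; j; k].
  have [w _ wX] := @local_word (tests X) isT.
  have Xl : {subset X <= light} by move=> x; rewrite !inE => /or3P[]/eqP->.
  by exists w => x y xX yX; rewrite (@patternE w) //; (by apply: Xl) || (by apply/wX/mem_tests).
pose H := enum [pred i | multiplicity i == 3].
exists (w ++ H ++ H ++ H); split=> [i|i i3|i j il jl].
- rewrite !mem_cat !mem_enum !inE !orbb.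
  have [il|il] := boolP (i \in light).
    have -> : i \in w.
      have := Hw i i il il; rewrite restrict_diag => /(congr1 size).
      rewrite size_nseq size_map -/(multiplicity i) -has_pred1 has_count => ->.
      by case/andP: il.
    by case/andP: il; case: multiplicity.
  rewrite (contraNF (wl i) il) /=; move: il (multiplicity_le3 i); rewrite inE /=.
  by case: multiplicity => [|[|[|[|]]]].
- have iH : 0 < count_mem i H by rewrite -has_count has_pred1 mem_enum inE i3.
  by rewrite !count_cat; lia.
- rewrite -Hw // /restrict !filter_cat.
  have -> : filter (pred2 i j) H = [::].
    apply/eqP; rewrite -[_ == _]negbK -has_filter; apply/hasPn => x.
    rewrite mem_enum inE => x3; apply: contraL x3 => /orP[]/eqP->.
      by case/andP: il => _; rewrite neq_ltn => ->.
    by case/andP: jl => _; rewrite neq_ltn => ->.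
  by rewrite !cats0.
Qed.

(** Given a tuple p, a bounded set X of variables suffices to compare the value
    of the global word at p with that of a word that agrees with f at p: one
    flagged variable, one variable with a triple occurrence and a nonempty
    entry, and either all other variables with nonempty entries or, if these
    are too many, five of them, which force a value of length more than four
    and hence zero in both cases. *)
Lemma term_of_local : semigroup_term_function f.
Proof.
have [w [wE w3 wl]] := global_word.
suff wf p : agrees w p.
  have [i] := some_present; rewrite -wE; case: w wf {wE w3 wl} => // j w wf _.
  exists j, w => p; apply: unfold1_inj; rewrite wf -eval_word_operation //.
    exact: normal_unfold1.
  exact: unfold1_mul.
pose u i := (unfold1 (p i)).2.
pose F := [seq i <- enum 'I_n | (multiplicity i != 0) && (unfold1 (p i)).1].
pose H := [seq i <- enum 'I_n | (multiplicity i == 3) && (u i != [::])].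
pose R := [seq i <- enum 'I_n | (i \in light) && (u i != [::])].
pose X := take 1 F ++ take 1 H ++ take 5 R.
pose Z := enum [pred i | multiplicity i == 0].
have [|v _ Hv] := @local_word [:: p, point (indicator Z) & tests X].
  rewrite /= size_tests !size_cat !size_take.
  have h k l : (if k < l then k else l) <= k by case: ifP => // /negbT; lia.
  have := leq_add (h 1 (size F)) (leq_add (h 1 (size H)) (h 5 (size R))).
  move: (_ + _) => s s7; have := leq_mul s7 s7; lia.
have vw : {subset v <= w}.
  have : unfold1 (f (point (indicator Z))) = identity_word.
    by apply: absent_indicator => i; rewrite mem_enum => /eqP.
  rewrite Hv; last by right; left.
  move=> /eqP; rewrite normal_eq1 eval_indicator => /allP vZ i /vZ.
  by rewrite mem_enum inE wE.
have vX : {in X &, forall i j, agrees v (point (test i j))}.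
  by move=> i j iX jX; apply: Hv; right; right; apply: mem_tests.
have Xv i : i \in X -> multiplicity i != 0 -> i \in v.
  move=> iX; rewrite (multiplicityE (vX i i iX iX)) => iv.
  by rewrite -has_pred1 has_count; lia.
rewrite /agrees Hv; last by left.
rewrite /normal /eval_word /=.
have -> : has (fun i => (unfold1 (p i)).1) v = has (fun i => (unfold1 (p i)).1) w.
  apply/hasP/hasP => [[i iv pi]|[i iw pi]]; first by exists i => //; apply: vw.
  case def_F : F => [|j F'].
    suff : i \in F by rewrite def_F.
    by rewrite mem_filter -wE iw pi mem_enum.
  have : j \in F by rewrite def_F mem_head.
  rewrite mem_filter => /andP[/andP[mj pj] _]; exists j => //; apply: Xv => //.
  by rewrite !mem_cat def_F /= mem_head.
congr (_, _); case def_H : H => [|i H'].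
  have [R5|R5] := leqP (size R) 5.
    congr (normal_word _ _).
    rewrite -[LHS](flatten_filter_nonnil u) -[RHS](flatten_filter_nonnil u).
    congr (flatten (map _ _)); apply: eq_from_restrict => i j.
    have mem_R k : k \in [seq i <- v | u i != [::]] ++ [seq i <- w | u i != [::]] ->
        (k \in X) && (k \in light).
      move=> kvw; have : (k \in w) && (u k != [::]).
        move: kvw; rewrite mem_cat !mem_filter => /orP[]/andP[-> //]; last by move->.
        by move/vw ->.
      move=> /andP[kw uk]; have kl : k \in light.
        rewrite inE lt0n -wE kw /=.
        rewrite ltn_neqAle multiplicity_le3 andbT; apply/eqP => mk.
        have : k \in H by rewrite mem_filter mk uk mem_enum.
        by rewrite def_H.
      rewrite kl andbT !mem_cat [take 5 R]take_oversize // [k \in R]mem_filter kl uk.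
      by rewrite mem_enum !orbT.
    move=> /mem_R/andP[iX il] /mem_R/andP[jX jl].
    have swap t : restrict i j [seq k <- t | u k != [::]]
                = [seq k <- restrict i j t | u k != [::]].
      by rewrite /restrict -!filter_predI; apply: eq_filter => k /=; rewrite andbC.
    by rewrite !swap wl // (patternE il jl _ _ (vX i j iX jX)) //; apply: vX.
  have R_w t : {subset take 5 R <= t} -> at_most_twice (flatten [seq u i | i <- t]) = false.
    move=> Rt; apply: (bad_of_many _ _ Rt).
    - by rewrite take_uniq // filter_uniq // enum_uniq.
    - by rewrite size_take R5.
    - by move=> i /mem_take; rewrite mem_filter => /andP[/andP[]].
  rewrite !normal_word_bad ?R_w // => i iR.
    have := mem_take iR; rewrite mem_filter => /andP[/andP[/andP[il _] _] _].
    by rewrite wE -lt0n.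
  have := mem_take iR; rewrite mem_filter => /andP[/andP[/andP[il _] _] _].
  by apply: Xv; rewrite -?lt0n // !mem_cat iR !orbT.
have iX : i \in X by rewrite !mem_cat def_H /= mem_head orbT.
have : i \in H by rewrite def_H mem_head.
rewrite mem_filter => /andP[/andP[/eqP mi ui] _].
rewrite !normal_word_bad ?(bad_of_triple ui) //; first exact: w3.
by move: mi; rewrite (multiplicityE (vX i i iX iX)); lia.
Qed.

End FinitelyRelated.

(** * Words in which every letter occurs twice *)

Definition each_twice (I : eqType) (w : seq I) := forall i, count_mem i w = 2.

(** Let i be the first letter whose second occurrence is reached.  An interval
    that meets the interval of i is open at this moment, so any two of them
    meet: i is a simplicial vertex of the intersection graph. *)
Lemma first_to_close (I : eqType) (w : seq I) : each_twice w -> w != [::] ->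
  exists i, forall j k, j != i -> k != i -> j != k ->
    ~~ separated i j (restrict i j w) -> ~~ separated i k (restrict i k w) ->
    ~~ separated j k (restrict j k w).
Proof.
move=> w2 w0.
have [v [i [v' [def_w uv iv]]]] : exists v i v', [/\ w = v ++ i :: v', uniq v & i \in v].
  have: ~~ uniq w.
    case: w w0 w2 => [//|x w] _ /(_ x) /=; rewrite eqxx => -[xw].
    by rewrite -has_pred1 has_count -[count_mem x w]add0n xw.
  elim/last_ind: w {w2 w0} => [//|w x IHw]; rewrite rcons_uniq negb_and negbK.
  have [uw|nw _] := boolP (uniq w).
    by rewrite orbF => xw; exists w, x, [::]; rewrite cats1.
  have [v [i [v' [-> uv iv]]]] := IHw nw.
  by exists v, i, (rcons v' x); rewrite -rcons_cons rcons_cat.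
have met j : j != i -> ~~ separated i j (restrict i j w) -> j \in v.
  move=> ji; apply: contraR => jv.
  have -> : restrict i j w = [:: i; i; j; j]; last by rewrite /separated inE eqxx.
  rewrite def_w /restrict filter_cat /= eqxx /=.
  have -> : filter (pred2 i j) v = [:: i].
    have -> : filter (pred2 i j) v = filter (pred1 i) v.
      apply: eq_in_filter => x xv /=; case: (x =P j) => [xj|]; last by rewrite orbF.
      by rewrite -xj xv in jv.
    by rewrite filter_pred1_uniq.
  have iv' : i \notin v'.
    have := w2 i; rewrite def_w count_cat /= eqxx count_uniq_mem // iv => E.
    by apply/count_memPn; move: E; rewrite /=; lia.
  have -> : filter (pred2 i j) v' = filter (pred1 j) v'.
    apply: eq_in_filter => x xv' /=; case: (x =P i) => // xi.
    by rewrite -xi xv' in iv'.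
  have : filter (pred1 j) v' = nseq (count_mem j v') j.
    by rewrite -size_filter; apply/all_pred1P; rewrite filter_all.
  suff -> : count_mem j v' = 2 by move->.
  by have := w2 j; rewrite def_w count_cat /= (count_memPn jv) eq_sym (negPf ji).
exists i => j k ji ki jk /(met j ji) jv /(met k ki) kv.
have size2 : size (restrict j k v) = 2.
  have -> : 2 = size [:: j; k] by [].
  apply/eqP; rewrite -uniq_size_uniq ?filter_uniq //= ?inE ?jk //.
  move=> x; rewrite mem_filter !inE /=.
  by case: eqP => [->|_]; rewrite ?jv //=; case: eqP => [->|]; rewrite ?kv.
have ur : uniq (restrict j k v) by rewrite filter_uniq.
rewrite def_w /restrict filter_cat -/(restrict j k v) /separated.
case: (restrict j k v) size2 ur => [|x [|y [|]]] //= _; rewrite inE andbT => xy.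
by rewrite !inE !eqseq_cons; apply/negP => /orP[]/and3P[/eqP xE /eqP yE _];
  rewrite xE yE eqxx in xy.
Qed.

Fixpoint chain (I : Type) (x : I) (s : seq I) :=
  if s is y :: s' then y :: x :: chain y s' else [:: x].

(** On x y z t this is the word xyxzytzt, whose intervals intersect exactly when
    they belong to consecutive letters. *)
Definition path_word (I : Type) (s : seq I) := if s is x :: s' then x :: chain x s' else [::].

Lemma count_path_word (I : eqType) (s : seq I) a : count a (path_word s) = count a s + count a s.
Proof.
case: s => //= x s; suff -> : count a (chain x s) = a x + (count a s + count a s) by lia.
by elim: s x => [|y s IHs] x /=; rewrite ?IHs; lia.
Qed.

Lemma restrict_double (I : eqType) (j : I) w : each_twice w -> restrict j j w = [:: j; j].
Proof. by move=> w2; rewrite restrict_diag w2. Qed.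

Lemma separatedC (I : eqType) (i j : I) w :
  separated i j (restrict i j w) = separated j i (restrict j i w).
Proof. by rewrite restrictC /separated !inE orbC. Qed.

Lemma separated_path_head (I : eqType) (x j : I) s : uniq (x :: s) -> j \in s ->
  separated x j (restrict x j (x :: chain x s)) = (index j s != 0).
Proof.
case: s => [//|y s] us js; have xj : x != j by apply: contraL us => /eqP->; rewrite /= js.
have xP : x \notin chain y s.
  have := count_path_word (y :: s) (pred1 x); rewrite /= => /eqP.
  rewrite -has_pred1 has_count -leqNgt leqn0; move: us => /= /andP[].
  rewrite inE negb_or eq_sym => /andP[/negPf-> /count_memPn->] _.
  by rewrite eq_sym.
have jP : count_mem j (path_word (y :: s)) = 2.
  by rewrite count_path_word count_uniq_mem ?js //; case/andP: us.
have -> : restrict x j (x :: chain x (y :: s)) =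
    x :: (if y == j then [:: j; x] else [:: x]) ++ nseq (count_mem j (chain y s)) j.
  rewrite /restrict /= eqxx /=; have [yx|yx] := eqVneq y x.
    by rewrite yx /= mem_head in us.
  have -> : filter (pred2 x j) (chain y s) = nseq (count_mem j (chain y s)) j.
    rewrite -size_filter -[RHS](_ : filter (pred1 j) (chain y s) = _); last first.
      by apply/all_pred1P; rewrite filter_all.
    apply: eq_in_filter => z zs /=; case: (z =P x) => // zx; by rewrite -zx zs in xP.
  by rewrite /=; case: eqP => // ->.
rewrite /= in jP *; case: eqP jP => [->|yj] /= jP.
  by rewrite /separated !inE !eqseq_cons eq_sym (negPf xj) /= !andbF.
by rewrite (_ : count_mem _ _ = 2) // /separated inE eqxx.
Qed.

Lemma separated_path_word (I : eqType) (i j : I) s : uniq s -> i \in s -> j \in s -> i != j ->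
  separated i j (restrict i j (path_word s))
    = (index j s != (index i s).+1) && (index i s != (index j s).+1).
Proof.
elim: s => [//|x s IHs] us.
rewrite !inE; have [->|ix] /= := eqVneq i x.
  move=> _ jxs xj; move: jxs; rewrite eqxx (eq_sym j) (negPf xj) /= => js.
  by rewrite separated_path_head // eqSS andbT.
have [->|jx] /= := eqVneq j x.
  move=> is_ _ _; rewrite separatedC separated_path_head // (eq_sym x).
  by rewrite (negPf ix) eqSS.
move=> is_ js ij; rewrite (eq_sym x) (negPf ix) !eqSS -IHs //; last by case/andP: us.
case: s {IHs} us is_ js => [//|y s] us _ _.
by congr separated; rewrite /restrict /= !(eq_sym x) (negPf ix) (negPf jx) /=.
Qed.

(** * Values in T of words in which every letter occurs twice *)

Lemma eval_word_neq1 n (p : 'I_n -> flagged_word) w :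
  w != [::] -> (forall i, p i != identity_word) -> eval_word p w != identity_word.
Proof.
case: w => [//|i w] _ /(_ i); rewrite /eval_word /identity_word /=.
by case: (p i) => -[] [|c u] //=; rewrite xpair_eqE /= andbF.
Qed.

Lemma double_perm n (w : seq 'I_n) : each_twice w -> perm_eq w (enum 'I_n ++ enum 'I_n).
Proof.
move=> w2; apply/allP => i _ /=.
by rewrite w2 count_cat count_uniq_mem ?enum_uniq // mem_enum.
Qed.

Lemma mem_double n (w : seq 'I_n) i : each_twice w -> i \in w.
Proof. by move=> w2; rewrite -has_pred1 has_count w2. Qed.

Lemma count_flatten_double n (u : 'I_n -> seq bool) (w : seq 'I_n) (a : pred bool) :
  each_twice w -> count a (flatten [seq u i | i <- w]) = 2 * \sum_i count a (u i).
Proof.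
move=> w2; rewrite count_flatten -map_comp sumnE big_map (perm_big _ (double_perm w2)) /=.
by rewrite big_cat /= !big_enum /= mul2n addnn.
Qed.

(** The tuples at which the value depends on how intervals intersect. *)
Definition visible n (p : 'I_n -> flagged_word) i j :=
  [&& (p i).2 == [:: true], (p j).2 == [:: false] &
      [forall k, (k != i) ==> (k != j) ==> ((p k).2 == [::])]].

Lemma visible_inj n (p : 'I_n -> flagged_word) i j i' j' :
  visible p i j -> visible p i' j' -> i = i' /\ j = j'.
Proof.
case/and3P => /eqP pi /eqP pj _ /and3P[/eqP pi' /eqP pj' /forallP H].
have Hi := H i; have Hj := H j; move: Hi Hj; rewrite pi pj !implybF !negbK.
have [ii' _|ii' /eqP ij'] := eqVneq i i'; last by move: pj'; rewrite -ij' pi.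
have [->//|jj'] := eqVneq j j'; rewrite implybF negbK => /eqP ji'.
by move: pi'; rewrite -ji' pj.
Qed.

(** If two entries are nonempty and the value is not zero, then each letter
    occurs in only one entry and once there, so that the tuple is visible.
    Otherwise the value is zero, or is a square determined by a single entry. *)
Lemma eval_invisible n (p : 'I_n -> flagged_word) v w : each_twice v -> each_twice w ->
  (forall i j, ~~ visible p i j) ->
  normal (eval_word p v) = normal (eval_word p w).
Proof.
move=> v2 w2 inv; rewrite /normal /eval_word /=.
have -> : has (fun i => (p i).1) v = has (fun i => (p i).1) w.
  by apply: eq_has_r => i; rewrite !mem_double.
congr (_, _); pose u i := (p i).2.
have [/existsP[i /existsP[j /and3P[ij ui uj]]]|one] :=
    boolP [exists i, exists j, [&& i != j, u i != [::] & u j != [::]]].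
  suff bad t : each_twice t -> at_most_twice (flatten [seq u k | k <- t]) = false.
    by rewrite !normal_word_bad ?bad.
  move=> t2; apply/negP; rewrite /at_most_twice !(count_flatten_double _ _ t2).
  have split2 a : \sum_k count a (u k)
      = count a (u i) + (count a (u j) + \sum_(k | (k != i) && (k != j)) count a (u k)).
    by rewrite (bigD1 i) //= (bigD1 j) 1?eq_sym.
  rewrite !split2 => /andP[ct cf].
  have rest k : k != i -> k != j -> u k = [::].
    move=> ki kj; apply: size0nil; rewrite size_count_bool.
    move: ct cf ui uj; rewrite -!size_eq0 !size_count_bool.
    by rewrite !(bigD1 k (P := fun k => (k != i) && (k != j))) ?ki //=; lia.
  have letter k l : size (u k) = 1 -> count_mem l (u k) = 1 -> u k = [:: l].
    by case: (u k) => [|c []] //= _; case: eqP => // ->.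
  have [szi szj tij fij] : [/\ size (u i) = 1, size (u j) = 1,
      count_mem true (u i) + count_mem true (u j) <= 1 &
      count_mem false (u i) + count_mem false (u j) <= 1].
    move: ct cf ui uj; rewrite -!size_eq0 !size_count_bool.
    move: (\sum_(k | _) _) (\sum_(k | _) _) => st sf.
    by move: (count_mem _ _) (count_mem _ _) (count_mem _ _) (count_mem _ _) => a b c d; split; lia.
  have [it|it] := eqVneq (count_mem true (u i)) 1.
    have := inv i j; rewrite /visible -/(u i) -/(u j) (letter i true) //.
    rewrite (letter j false) //; last by move: szj it; rewrite size_count_bool; lia.
    by move=> /negP[]; rewrite !eqxx; apply/forallP => k; do 2![apply/implyP => ?]; apply/eqP/rest.
  have := inv j i; rewrite /visible -/(u i) -/(u j) (letter i false) //; last first.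
    by move: szi it; rewrite size_count_bool; lia.
  rewrite (letter j true) //; last by move: szi szj it; rewrite !size_count_bool; lia.
  by move=> /negP[]; rewrite !eqxx; apply/forallP => k; do 2![apply/implyP => ?]; apply/eqP/rest.
congr (normal_word _ _); rewrite -[LHS](flatten_filter_nonnil u) -[RHS](flatten_filter_nonnil u).
congr (flatten (map _ _)).
have [/existsP[i ui]|none] := boolP [exists i, u i != [::]]; last first.
  have f0 t : [seq k <- t | u k != [::]] = [::].
    apply/eqP; rewrite -[_ == _]negbK -has_filter; apply/hasPn => k _.
    by move: none; rewrite negb_exists => /forallP/(_ k).
  by rewrite !f0.
have fi t : each_twice t -> [seq k <- t | u k != [::]] = [:: i; i].
  move=> t2; rewrite -(restrict_double i t2); apply: eq_filter => k /=; rewrite orbb.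
  have [->//|ki] := eqVneq k i; apply: contraNF one => uk.
  by apply/existsP; exists k; apply/existsP; exists i; rewrite ki uk.
by rewrite !fi.
Qed.

Lemma separated_map_pred1 (I : eqType) (i j : I) v : i != j -> {subset v <= [:: i; j]} ->
  separated true false (map (pred1 i) v) = separated i j v.
Proof.
move=> ij vij; have ji : (j == i) = false by rewrite eq_sym (negPf ij).
rewrite /separated !inE; apply/orP/orP.
  have vE : v = [seq if c then i else j | c : bool <- map (pred1 i) v].
    rewrite -map_comp -[LHS]map_id; apply/eq_in_map => x /vij; rewrite !inE /=.
    by case: eqP => [->|_] //= /eqP.
  by case=> /eqP E; [left|right]; rewrite vE E /=.
by case=> /eqP -> /=; rewrite !eqxx !ji; [left|right].
Qed.

(** With three variables, a visible tuple sets a flag. *)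
Lemma eval_visible n (p : 'I_n -> flagged_word) w i j : 2 < n -> each_twice w ->
  (forall i, p i != identity_word) -> visible p i j ->
  normal (eval_word p w)
   = (true, if separated i j (restrict i j w) then [:: true; true; false; false] else zero_word).
Proof.
move=> n2 w2 p1 /and3P[/eqP pi /eqP pj /forallP pk].
have ij : i != j by apply/eqP => ij; rewrite ij pj in pi.
rewrite /normal /eval_word /=.
have -> : has (fun i => (p i).1) w.
  have [k ki kj] : exists2 k : 'I_n, k != i & k != j.
    have : 0 < #|~: [set i; j]|.
      by have := cardsC [set i; j]; rewrite cards2 ij card_ord; lia.
    by case/card_gt0P => k; rewrite !inE negb_or => /andP[]; exists k.
  apply/hasP; exists k; first exact: mem_double.
  have := pk k; rewrite ki kj /= => /eqP; have := p1 k; rewrite /identity_word.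
  by case: (p k) => -[] //= u /[swap] ->.
have L : flatten [seq (p i).2 | i <- w] = map (pred1 i) (restrict i j w).
  apply: (@flatten_two_letters _ (fun k => (p k).2)) => // k ki kj.
  by have := pk k; rewrite ki kj => /eqP.
have Lc a : count a (flatten [seq (p i).2 | i <- w]) = 2 * (a true + a false).
  rewrite (@count_flatten_double _ (fun k => (p k).2)) // (bigD1 i) //= (bigD1 j) 1?eq_sym //=.
  rewrite big1 ?pi ?pj /= ?addn0 // => k /andP[ki kj].
  by have := pk k; rewrite ki kj => /eqP ->.
rewrite /normal_word /at_most_twice !Lc /= -(count_predT (flatten _)) Lc /=.
rewrite L (@separated_map_pred1 _ i j) // => k; rewrite mem_filter !inE => /andP[].
by rewrite /= => ->.
Qed.

(** * Cycles, and the failure of finite relatedness *)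

Definition cycle_edge n (i j : nat) := (j == i.+1) || ((i.+1 == n) && (j == 0)).

Definition cycle_adjacent n (i j : nat) := cycle_edge n i j || cycle_edge n j i.

(** The cycle, cut open at the edge from v to its successor. *)
Definition rotation n (v : 'I_n.+1) : seq 'I_n.+1 :=
  [seq inord ((v.+1 + t) %% n.+1) | t <- iota 0 n.+1].

Lemma rotation_spec n (v : 'I_n.+1) :
  [/\ uniq (rotation v), forall i, i \in rotation v &
      forall i, index i (rotation v) = if i <= v then i + (n - v) else i - v.+1].
Proof.
pose pos (i : 'I_n.+1) := if i <= v then i + (n - v) else i - v.+1.
have pos_lt i : pos i < n.+1.
  by rewrite /pos; case: ifP; have := ltn_ord i; have := ltn_ord v; lia.
have nth_pos i : nth v (rotation v) (pos i) = i.
  rewrite (nth_map 0) ?size_iota // nth_iota // add0n; apply: val_inj.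
  rewrite /= inordK ?ltn_pmod // /pos; have := ltn_ord i; have := ltn_ord v.
  case: ifP => iv vn i_n; last by rewrite modn_small; lia.
  have -> : v.+1 + (i + (n - v)) = n.+1 + i by lia.
  by rewrite modnDl modn_small.
have sz : size (rotation v) = n.+1 by rewrite size_map size_iota.
have all_in i : i \in rotation v by rewrite -[i]nth_pos mem_nth // sz.
have un : uniq (rotation v).
  rewrite (uniq_size_uniq (enum_uniq 'I_n.+1)) ?size_enum_ord ?sz //.
  by move=> i; rewrite mem_enum all_in.
by split=> // i; rewrite -{1}[i]nth_pos index_uniq // sz.
Qed.

Definition arc_word n (v : 'I_n.+1) := path_word (rotation v).

Lemma arc_word_double n (v : 'I_n.+1) : each_twice (arc_word v).
Proof.
move=> i; have [un all_in _] := rotation_spec v.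
by rewrite count_path_word count_uniq_mem // all_in.
Qed.

Lemma separated_arc_word n (v i j : 'I_n.+1) : i != j ->
  ~~ ((i == v) && cycle_edge n.+1 i j || (j == v) && cycle_edge n.+1 j i) ->
  separated i j (restrict i j (arc_word v)) = ~~ cycle_adjacent n.+1 i j.
Proof.
have [un all_in idx] := rotation_spec v.
move=> ij; rewrite separated_path_word // !idx.
move: ij; rewrite /cycle_adjacent /cycle_edge -!val_eqE /=.
have := ltn_ord i; have := ltn_ord j; have := ltn_ord v.
by case: (leqP i v) => ?; case: (leqP j v) => ?; lia.
Qed.

Section NotFinitelyRelated.
Variable K : nat.
Let n := K.+4.

(** What a word in which every variable occurs twice would have as its value,
    if the intersection graph of its intervals were the cycle of length n. *)
Definition cycle_value (p : 'I_n -> flagged_word) : flagged_word :=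
  if [pick ij | visible p ij.1 ij.2] is Some ij then
    (true, if cycle_adjacent n ij.1 ij.2 then zero_word else [:: true; true; false; false])
  else normal (eval_word p (arc_word ord0)).

Definition cycle_operation : operation FlagWord n :=
  fun p => to_flag_word (cycle_value (val \o p)).

Lemma val_neq1 (p : 'I_n -> FlagWord) i : (val \o p) i != identity_word.
Proof. by rewrite /=; case: (p i) => x /= /andP[]. Qed.

Lemma nonnil_of_twice (w : seq 'I_n) : each_twice w -> w != [::].
Proof. by move=> w2; apply: contraTneq (mem_double ord0 w2) => ->. Qed.

Lemma val_cycle_operation (p : 'I_n -> FlagWord) : val (cycle_operation p) = cycle_value (val \o p).
Proof.
rewrite val_to_flag_word; rewrite /cycle_value; case: pickP => [ij _|_].
- by case: ifP.
- by rewrite normal_id.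
- by [].
rewrite normal_eq1; apply: eval_word_neq1; last exact: val_neq1.
exact/nonnil_of_twice/arc_word_double.
Qed.

Lemma cycle_value_visible (p : 'I_n -> flagged_word) i j : visible p i j ->
  cycle_value p = (true, if cycle_adjacent n i j then zero_word else [:: true; true; false; false]).
Proof.
rewrite /cycle_value => pij; case: pickP => [[i' j'] /= pij'|/(_ (i, j))/=]; last by rewrite pij.
by have [-> ->] := visible_inj pij pij'.
Qed.

Lemma eval_word_val (i : 'I_n) w (p : 'I_n -> FlagWord) :
  val (word_operation i w p) = normal (eval_word (val \o p) (i :: w)).
Proof. by apply: eval_word_operation => //; apply: normal_val. Qed.

(** The tuple p tests the edge of the cycle that starts at v. *)
Definition hits (p : 'I_n -> flagged_word) (v : 'I_n) :=
  exists i j, visible p i j /\ (i == v) && cycle_edge n i j || (j == v) && cycle_edge n j i.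

(** Each tuple tests at most one edge, and the cycle has more than K edges. *)
Lemma unhit_edge (ps : seq ('I_n -> FlagWord)) : size ps <= K ->
  exists v, forall p, List.In p ps -> ~ hits (val \o p) v.
Proof.
move=> psK.
have [E EK EP] : exists2 E : seq 'I_n, size E <= size ps &
    forall p v, List.In p ps -> hits (val \o p) v -> v \in E.
  elim: ps {psK} => [|p ps [E EK EP]]; first by exists [::].
  have [[v0 pv0]|pv] := pselect (exists v, hits (val \o p) v); last first.
    exists E => [|q v [<-|]]; [exact: leq_trans EK _| |exact: EP].
    by move=> pv'; case: pv; exists v.
  exists (v0 :: E) => // q v [<-|qps pv]; last by rewrite inE (EP q) ?orbT.
  move: pv0 => [i [j [pij e0]]] [i' [j' [/(visible_inj pij)[<- <-] e]]].
  suff -> : v = v0 by rewrite mem_head.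
  apply: val_inj; move: e0 e; rewrite /cycle_edge -!val_eqE /= /n.
  have := ltn_ord i; have := ltn_ord j; rewrite /n; lia.
have [v vE] : exists v, v \notin E.
  apply/existsP; apply: contraT; rewrite negb_exists => /forallP allE.
  have : #|'I_n| <= size E.
    rewrite cardE; apply: uniq_leq_size; first exact: enum_uniq.
    by move=> v _; apply: negPn (allE v).
  by rewrite card_ord => /leq_trans/(_ EK)/leq_trans/(_ psK); rewrite /n; lia.
by exists v => p pps pv; move: vE; rewrite (EP p).
Qed.

Lemma cycle_operation_local : locally_term K cycle_operation.
Proof.
move=> ps /unhit_edge[v Hv].
have w2 := arc_word_double v; have := nonnil_of_twice w2.
have Hs := @separated_arc_word _ v.
move: (arc_word v) w2 Hs => w w2 Hs; case: w w2 Hs => // i w w2 Hs _.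
exists i, w => p /Hv pv; apply: val_inj.
rewrite val_cycle_operation eval_word_val.
have [[k [l kl]]|none] := pselect (exists k l, visible (val \o p) k l).
  rewrite (cycle_value_visible kl) (eval_visible _ _ _ kl) //; last exact: val_neq1.
  rewrite Hs; first by case: cycle_adjacent.
    by case/and3P: kl => /eqP pk /eqP pl _; apply/eqP => E; rewrite E pl in pk.
  by apply/negP => e; apply: pv; exists k, l.
have inv k l : ~~ visible (val \o p) k l by apply/negP => kl; apply: none; exists k, l.
rewrite /cycle_value; case: pickP => [kl|_]; first by rewrite (negPf (inv _ _)).
by apply: eval_invisible => //; apply: arc_word_double.
Qed.

Definition flagged_test (i j : 'I_n) : 'I_n -> FlagWord := fun k =>
  to_flag_word (true, if k == i then [:: true] else if k == j then [:: false] else [::]).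

Lemma val_flagged_test i j k : val (flagged_test i j k)
  = (true, if k == i then [:: true] else if k == j then [:: false] else [::]).
Proof. by rewrite val_to_flag_word //; case: ifP => // _; case: ifP. Qed.

Lemma eval_flagged_test i j w : w != [::] ->
  eval_word (val \o flagged_test i j) w = (true, map (pred1 i) (restrict i j w)).
Proof.
move=> w0; rewrite /eval_word; congr (_, _).
  by case: w w0 => //= k w _; rewrite val_flagged_test.
apply: (@flatten_two_letters _ (fun k => (val (flagged_test i j k)).2)) => [|/negPf ji|k /negPf ki /negPf kj];
  by rewrite val_flagged_test /= ?eqxx ?ji ?ki ?kj.
Qed.

Lemma visible_flagged_test i j : i != j -> visible (val \o flagged_test i j) i j.
Proof.
move=> ij; rewrite /visible /= !val_flagged_test /= !eqxx (eq_sym j) (negPf ij) /=.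
apply/forallP => k; apply/implyP => /negPf ki; apply/implyP => /negPf kj.
by rewrite val_flagged_test ki kj.
Qed.

(** The single tests show that every letter of a word that induces the operation
    occurs twice, and the visible ones that its intersection graph is the cycle.
    But no vertex of a cycle of length at least 4 is simplicial: its two
    neighbours are not adjacent. *)
Lemma cycle_operation_not_term : ~ semigroup_term_function cycle_operation.
Proof.
move=> [i0 [w0 Hf]]; pose w := i0 :: w0.
have fE (p : 'I_n -> FlagWord) : cycle_value (val \o p) = normal (eval_word (val \o p) w).
  by rewrite -eval_word_val -Hf val_cycle_operation.
have w2 : each_twice w.
  move=> i; have := fE (flagged_test i i).
  have v2 := arc_word_double (ord0 : 'I_n); have v0 := nonnil_of_twice v2.
  rewrite /cycle_value; case: pickP => [kl /and3P[_ + _]|_].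
    by rewrite /= val_flagged_test; case: (_ == i).
  rewrite !eval_flagged_test //.
  rewrite (restrict_double i v2) restrict_diag map_nseq /= eqxx.
  rewrite /normal normal_word_nseq => -[] /(congr1 size); rewrite size_nseq /=; lia.
have sep i j : i != j -> separated i j (restrict i j w) = ~~ cycle_adjacent n i j.
  move=> ij; have := fE (flagged_test i j).
  have vis := visible_flagged_test ij.
  rewrite (cycle_value_visible vis) (eval_visible _ w2 _ vis) //; last exact: val_neq1.
  by case: cycle_adjacent; case: separated.
have [i Hi] := first_to_close w2 isT.
pose j : 'I_n := inord (if i.+1 == n then 0 else i.+1).
pose k : 'I_n := inord (if i == 0 :> nat then n.-1 else i.-1).
have i_n := ltn_ord i.
have jE : (i.+1 = n /\ val j = 0) \/ (i.+1 < n /\ val j = i.+1).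
  rewrite /j; case: (i.+1 =P n) => ein; [left|right]; rewrite /= inordK //;
    by move: i_n ein; rewrite /n; lia.
have kE : (nat_of_ord i = 0 /\ val k = n.-1) \/ (0 < i /\ val k = i.-1).
  rewrite /k; case: (nat_of_ord i =P 0) => i0n; [left|right]; rewrite /= inordK //;
    by move: i_n i0n; rewrite /n; lia.
have [ji ki jk] : [/\ j != i, k != i & j != k].
  by rewrite -!val_eqE; move: jE kE i_n; rewrite /= /n; split; lia.
have := Hi j k ji ki jk; rewrite !sep // 1?eq_sym // !negbK.
rewrite /cycle_adjacent /cycle_edge.
by move: jE kE i_n; rewrite /= /n; lia.
Qed.

End NotFinitelyRelated.

Theorem corollary5p4 :
  exists T : semigroupType,
    ~ finitely_related_semigroup T /\ finitely_related_semigroup (semigroup1 T).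
Proof.
exists FlagWord; split.
  apply: not_finitely_related_of_locally_term => K.
  exists K.+4, (cycle_operation (K := K)); split=> //.
    exact: cycle_operation_local.
  exact: cycle_operation_not_term.
rewrite /semigroup1; case: pselect => [idT|noT] /=; first by case: (flag_word_no_identity idT).
pose g (x : add_identity FlagWord) : bool * 4.-bseq bool :=
  ((unfold1 x).1, insub_bseq 4 (unfold1 x).2).
have g_inj : injective g.
  move=> x y gxy; have valE z : val (insub_bseq 4 (unfold1 z).2) = (unfold1 z).2.
    by rewrite val_insubd -(normal_unfold1 z) size_normal_word.
  have E1 := congr1 fst gxy; have E2 := congr1 snd gxy; rewrite /= in E1 E2.
  apply: unfold1_inj; rewrite [LHS]surjective_pairing [RHS]surjective_pairing E1.
  by rewrite -valE E2 valE.
apply: (@finitely_related_of_locally_term _ _ g 51 g_inj) => n f n0.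
exact: term_of_local.
Qed.
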